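(* Let $n=3$ and let $\widetilde{M}^{\pi_{\mathcal{B},D}}(s_1)$, $\widetilde{M}^{\pi_{\mathcal{B},D}}(s_2)$ be the modified monodromy operators on $V^{\otimes 3}$ attached to the simple reflections $s_1,s_2\in S_3$, and $\mathcal{R}(x;\underline{\phi})$ the operator on $V\otimes V$, as defined in the context. Then $$\widetilde{M}^{\pi_{\mathcal{B},D}}(s_1)=\mathcal{R}_{23}\bigl(z_1-z_2;\underline{\phi}+\widehat{\underline{\Psi}}(\kappa)_1\bigr),\qquad \widetilde{M}^{\pi_{\mathcal{B},D}}(s_2)=\mathcal{R}_{12}\bigl(z_2-z_3;\underline{\phi}+\widehat{\underline{\Psi}}(-\kappa)_3\bigr)$$ as linear operators on $V^{\otimes 3}$ (depending meromorphically on $\mathbf{z}=(z_1,z_2,z_3)$), where for $t\in\mathbb{C}$ $$\underline{\Psi}^{(1)}(t)=(-t,0,-\pi\sqrt{-1}\log(p)^{-1}),\quad \underline{\Psi}^{(2)}(t)=(0,-t,-\pi\sqrt{-1}\log(p)^{-1}),\quad \underline{\Psi}^{(3)}(t)=(0,0,t).$$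
   Context: Fix $0<p<1$, generic $\kappa\in\mathbb{C}$, generic $\underline{\phi}=(\phi_1,\phi_2,\phi_3)\in\mathbb{C}^3$; $p^a:=e^{a\log p}$ with $\log p\in\mathbb R$. Let $\theta(z;p)=\prod_{m\ge0}(1-p^mz)(1-p^{m+1}/z)$, $\theta(z_1,\dots,z_r;p)=\prod_j\theta(z_j;p)$, and $$A^u(x)=\frac{\theta(p^{2\kappa},p^{u-x};p)}{\theta(p^u,p^{2\kappa-x};p)}p^{(2\kappa-u)x},\quad B^u(x)=\frac{\theta(p^{2\kappa-u},p^{-x};p)}{\theta(p^{2\kappa-x},p^{-u};p)}p^{2\kappa(x-u)},\quad c(x)=p^{2\kappa x}\frac{\theta(p^{2\kappa+x};p)}{\theta(p^x;p)}.$$ $V=\mathbb{C}v_1\oplus\mathbb{C}v_2\oplus\mathbb{C}v_3$ with parity $p(1)=p(2)=\overline0$, $p(3)=\overline1$. The operator $\mathcal{R}(x;\underline\phi)$ on $V\otimes V$ is given by $\mathcal{R}(x;\underline{\phi})v_i\otimes v_i=(-1)^{p(i)}\frac{c(x)}{c((-1)^{p(i)}x)}v_i\otimes v_i$ and, for $i\ne j$, $\mathcal{R}(x;\underline{\phi})v_i\otimes v_j=A^{\phi_i-\phi_j}(x)v_i\otimes v_j+(-1)^{p(i)+p(j)}B^{\phi_i-\phi_j}(x)v_j\otimes v_i$. $\mathcal R_{12}=\mathcal R\otimes\mathrm{Id}_V$, $\mathcal R_{23}=\mathrm{Id}_V\otimes\mathcal R$. For a family $Q(\underline\phi)$ of linear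 operators on $V^{\otimes 3}$ and vectors $\underline\Psi^{(j)}\in\mathbb{C}^3$ ($j=1,2,3$), $Q(\underline\phi+\widehat{\underline\Psi}_i)$ denotes the operator acting on $V^{\otimes(i-1)}\otimes\mathbb{C}v_j\otimes V^{\otimes(3-i)}$ as $Q(\underline\phi+\underline\Psi^{(j)})$. Connection coefficients (general $n\ge 2$): $S_n$ is the symmetric group with simple transpositions $s_i=(i\ i{+}1)$ and length function $l$; for $I\subseteq\{1,\dots,n-1\}$, $S_n^I=\{w\in S_n\,|\,l(ws_i)=l(w)+1\ \forall i\in I\}$. Given signs $\epsilon=(\epsilon_i)_{i\in I}$ and $\gamma\in\mathbb{C}^n$ with $\gamma_i-\gamma_{i+1}=2\epsilon_i\kappa$ for $i\in I$, the coefficients $m^{I,\epsilon,s_i}_{\sigma,\tau}(\mathbf{z};\gamma)$ ($\sigma,\tau\in S_n^I$, $1\le i<n$) are: if $\sigma\in S_n^I$ and $s_{n-i}\sigma\notin S_n^I$, then $m^{I,\epsilon,s_i}_{\sigma,\sigma}=\epsilon_{i_\sigma}\frac{c(z_i-z_{i+1})}{c(\epsilon_{i_\sigma}(z_i-z_{i+1}))}$, where $i_\sigma\in I$ is the unique index with $s_{n-i}\sigma=\sigma s_{i_\sigma}$; if $\sigma,s_{n-i}\sigma\in S_n^I$, then with $u=\gamma_{\sigma^{-1}(n-i)}-\gamma_{\sigma^{-1}(n-i+1)}$, $m^{I,\epsilon,s_i}_{\sigma,\sigma}=A^{u}(z_i-z_{i+1})$ and $m^{I,\epsilon,s_i}_{s_{n-i}\sigma,\sigma}=B^{u}(z_i-z_{i+1})$;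 all other entries are zero. (These are the connection coefficients of the quantum affine KZ equations attached to the principal series module $M^{I,\epsilon}(\gamma)$ of the extended affine Hecke algebra of type $A_{n-1}$.) Modified monodromy operators: for $\mathbf r=(r_1,r_2,r_3)\in\mathbb{Z}_{\ge0}^3$ with $r_1+r_2+r_3=n$, let $\mathcal{K}_n[\mathbf r]\subset\{1,2,3\}^n$ be the set of tuples with exactly $r_j$ entries equal to $j$; $S_n$ acts by $(w\alpha)_i=\alpha_{w^{-1}(i)}$. Let $\alpha^{(\mathbf r)}=(3,\dots,3,2,\dots,2,1,\dots,1)$ ($r_3$ threes, $r_2$ twos, $r_1$ ones), $I^{(\mathbf r)}=\{1,\dots,n-1\}\setminus\{r_3,r_2+r_3\}$, and for $\alpha\in\mathcal K_n[\mathbf r]$ let $w_\alpha\in S_n^{I^{(\mathbf r)}}$ be the unique element with $w_\alpha\alpha^{(\mathbf r)}=\alpha$. Let $\epsilon^{(\mathbf r)}_i=-$ if $i<r_3$, $+$ otherwise, and $$\gamma_i^{(\mathbf{r})}=\begin{cases}\eta_3^{(\mathbf{r})}+\phi_3+2i\kappa,& i\le r_3,\\ \eta_2^{(\mathbf{r})}+\phi_2-2(i-r_3)\kappa,& r_3<i\le r_3+r_2,\\ \eta_1^{(\mathbf{r})}+\phi_1-2(i-r_2-r_3)\kappa,& r_3+r_2<i\le n,\end{cases}$$ with $\eta_1^{(\mathbf{r})}=-\pi\sqrt{-1}\,r_3\log(p)^{-1}+(r_1+1)\kappa$, $\eta_2^{(\mathbf{r})}=-\pi\sqrt{-1}\,r_3\log(p)^{-1}+(r_2+1)\kappa$,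 $\eta_3^{(\mathbf{r})}=-\pi\sqrt{-1}(n-1)\log(p)^{-1}-(r_3+1)\kappa$. For $w\in S_n^{I^{(\mathbf r)}}$ let $\eta(w)=\#\{(i,j)\,|\,1\le j\le r_3<i\le n,\ w(i)<w(j)\}$. With $\mathbf v_\alpha=v_{\alpha_1}\otimes\cdots\otimes v_{\alpha_n}$, the operator $\widetilde M^{\pi_{\mathcal B,D}}(s_i)$ on $V^{\otimes n}$ is $$\widetilde{M}^{\pi_{\mathcal{B},D}}(s_i)\mathbf{v}_\beta=\sum_{\alpha\in\mathcal{K}_n[\mathbf{r}]}(-1)^{\eta(w_\alpha)+\eta(w_\beta)}\,m_{w_{\alpha},w_{\beta}}^{I^{(\mathbf{r})},\epsilon^{(\mathbf{r})},s_i}(\mathbf{z};\gamma^{(\mathbf{r})})\,\mathbf{v}_\alpha,\qquad\beta\in\mathcal{K}_n[\mathbf{r}].$$ *)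

(* Defs.v *)
From HB Require Import structures.
From mathcomp Require Import all_boot all_order all_algebra all_fingroup.
From mathcomp Require Import reals topology normedtype sequences exp trigo.
From mathcomp Require Import complex.

Set Implicit Arguments.
Unset Strict Implicit.
Unset Printing Implicit Defensive.

Import Order.TTheory GRing.Theory Num.Theory.
Import numFieldNormedType.Exports.

Local Open Scope ring_scope.

(* The explicit numClosedFieldType target makes the normed topology of
   numFieldNormedType.Exports available on the complex numbers. *)
Definition Cplx (R : realType) : numClosedFieldType := R[i].

Definition cexp (R : realType) (a : Cplx R) : Cplx R :=
  ((expR (complex.Re a))%:C *
   (cos (complex.Im a) +i* sin (complex.Im a)))%C.

(* p^a := e^{a log p}, with log p the real logarithm *)
Definition cpow (R : realType) (p : R) (a : Cplx R) : Cplx R :=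
  cexp (a * (ln p)%:C%C).

(* pi * sqrt(-1) / log p *)
Definition ipi_log (R : realType) (p : R) : Cplx R := (0 +i* (pi / ln p))%C.

Definition theta (R : realType) (p : R) (z : Cplx R) : Cplx R :=
  limn (fun N => \prod_(m < N)
    ((1 - p%:C%C ^+ m * z) * (1 - p%:C%C ^+ m.+1 / z)) : Cplx R).

(* theta(p^a; p) *)
Definition thetap (R : realType) (p : R) (a : Cplx R) : Cplx R :=
  theta p (cpow p a).

Definition Acoef (R : realType) (p : R) (kappa u x : Cplx R) : Cplx R :=
  (thetap p (2%:R * kappa) * thetap p (u - x)) /
  (thetap p u * thetap p (2%:R * kappa - x)) *
  cpow p ((2%:R * kappa - u) * x).

Definition Bcoef (R : realType) (p : R) (kappa u x : Cplx R) : Cplx R :=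
  (thetap p (2%:R * kappa - u) * thetap p (- x)) /
  (thetap p (2%:R * kappa - x) * thetap p (- u)) *
  cpow p (2%:R * kappa * (x - u)).

Definition ccoef (R : realType) (p : R) (kappa x : Cplx R) : Cplx R :=
  cpow p (2%:R * kappa * x) * (thetap p (2%:R * kappa + x) / thetap p x).

(* The indices 1, 2, 3 of the basis of V are the elements 0, 1, 2 of 'I_3;
   likewise for the coordinates of phi, Psi and z. *)
Definition one3 : 'I_3 := @Ordinal 3 0 isT.
Definition two3 : 'I_3 := @Ordinal 3 1 isT.
Definition three3 : 'I_3 := @Ordinal 3 2 isT.

Definition parity (i : 'I_3) : bool := i == three3.

Definition sgn (R : realType) (b : bool) : Cplx R := (-1) ^+ b.

(* The n-th tensor power of V, in coordinates with respect to the basis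
   v_a = v_{a_1} (x) ... (x) v_{a_n}, where a ranges over {1,2,3}^n. *)
Definition word (n : nat) := {ffun 'I_n -> 'I_3}.

Definition tens (R : realType) (n : nat) := {ffun word n -> (Cplx R)^o}.

Definition bvec (R : realType) (n : nat) (a : word n) : tens R n :=
  [ffun b => (b == a)%:R].

Definition linext_fun (R : realType) (n : nat) (f : word n -> tens R n)
    (v : tens R n) : tens R n :=
  \sum_a (v a : Cplx R) *: f a.

Lemma linext_fun_is_linear (R : realType) (n : nat) (f : word n -> tens R n) :
  linear (linext_fun f).
Proof.
move=> k u v; rewrite /linext_fun scaler_sumr -big_split /=.
by apply: eq_bigr => a _; rewrite !ffunE scalerDl scalerA.
Qed.

HB.instance Definition _ (R : realType) (n : nat) (f : word n -> tens R n) :=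
  GRing.isLinear.Build (Cplx R) (tens R n) (tens R n) _ (linext_fun f)
    (linext_fun_is_linear f).

(* the linear operator sending v_a to f a *)
Definition linext (R : realType) (n : nat) (f : word n -> tens R n) :
    'End(tens R n) :=
  linfun (linext_fun f).

Definition lword (m n : nat) (w : word (m + n)) : word m :=
  [ffun i => w (lshift n i)].

Definition rword (m n : nat) (w : word (m + n)) : word n :=
  [ffun j => w (rshift m j)].

Definition tensv (R : realType) (m n : nat) (u : tens R m) (v : tens R n) :
    tens R (m + n) :=
  [ffun w => (u (lword w) : Cplx R) * v (rword w)].

Definition tensop (R : realType) (m n : nat)
    (P : 'End(tens R m)) (Q : 'End(tens R n)) : 'End(tens R (m + n)) :=
  linext (fun w => tensv (P (bvec R (lword w))) (Q (bvec R (rword w)))).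

Definition word2 (i j : 'I_3) : word 2 :=
  [ffun k : 'I_2 => if k == ord0 then i else j].

Definition Rmat (R : realType) (p : R) (kappa x : Cplx R)
    (phi : 'I_3 -> Cplx R) : 'End(tens R 2) :=
  linext (fun w =>
    let i := w ord0 in
    let j := w ord_max in
    if i == j then
      (sgn R (parity i) *
         (ccoef p kappa x / ccoef p kappa (sgn R (parity i) * x))) *:
      bvec R (word2 i i)
    else
      Acoef p kappa (phi i - phi j) x *: bvec R (word2 i j) +
      ((-1) ^+ (parity i + parity j)%N * Bcoef p kappa (phi i - phi j) x) *:
      bvec R (word2 j i)).

Definition R12 (R : realType) (p : R) (kappa x : Cplx R)
    (phi : 'I_3 -> Cplx R) : 'End(tens R 3) :=
  tensop (m := 2) (n := 1) (Rmat p kappa x phi) \1%VF.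

Definition R23 (R : realType) (p : R) (kappa x : Cplx R)
    (phi : 'I_3 -> Cplx R) : 'End(tens R 3) :=
  tensop (m := 1) (n := 2) \1%VF (Rmat p kappa x phi).

(* Q(phi + hat Psi_k), where Psi j stands for the vector Psi^(j) *)
Definition dynshift (R : realType)
    (Q : ('I_3 -> Cplx R) -> 'End(tens R 3)) (phi : 'I_3 -> Cplx R)
    (Psi : 'I_3 -> 'I_3 -> Cplx R) (k : 'I_3) : 'End(tens R 3) :=
  linext (fun w => Q (phi \+ Psi (w k)) (bvec R w)).

Definition vec3 (R : realType) (a b c : Cplx R) (i : 'I_3) : Cplx R :=
  [:: a; b; c]`_i.

Definition Psi (R : realType) (p : R) (t : Cplx R) (j : 'I_3) :
    'I_3 -> Cplx R :=
  if j == one3 then vec3 (- t) 0 (- ipi_log p)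
  else if j == two3 then vec3 0 (- t) (- ipi_log p)
  else vec3 0 0 t.

(* Below, the rank called n in the mathematics is n.+1. Positions 1, ..., n.+1
   are the elements 0, ..., n of 'I_n.+1, and the indices 1, ..., n of the
   simple transpositions are the elements 0, ..., n.-1 of 'I_n. For k : 'I_n
   standing for the index i, lpos k and rpos k are the positions i and i + 1,
   and rev_ord k stands for the index (n.+1) - i. *)
Definition lpos (n : nat) (k : 'I_n) : 'I_n.+1 := widen_ord (leqnSn n) k.

Definition rpos (n : nat) (k : 'I_n) : 'I_n.+1 := lift ord0 k.

(* Composition of permutations as functions: mathcomp's product is the
   opposite one, (v * w)%g i = w (v i). *)
Definition pcomp (n : nat) (w v : 'S_n) : 'S_n := (v * w)%g.

Definition strans (n : nat) (k : 'I_n) : 'S_n.+1 := tperm (lpos k) (rpos k).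

Definition simples (n : nat) : {set 'S_n.+1} := [set strans k | k : 'I_n].

Lemma tperm_simples (n : nat) (d : nat) (x y : 'I_n.+1) :
  y = (x + d)%N :> nat -> tperm x y \in <<simples n>>%g.
Proof.
elim: d y => [|d IHd] y.
  rewrite addn0 => eq_yx; have -> : y = x by apply: val_inj.
  by rewrite tperm1 group1.
rewrite addnS => eq_y.
have lt_d : (x + d < n)%N by rewrite -ltnS -eq_y ltn_ord.
pose k := Ordinal lt_d.
have sk : strans k \in <<simples n>>%g by rewrite mem_gen // imset_f.
have eq_rpos : rpos k = y.
  by apply: val_inj; rewrite /= /bump leq0n add1n -eq_y.
have [xk | neq_xk] := eqVneq x (lpos k).
  by rewrite xk -eq_rpos; exact: sk.
have -> : tperm x y = (tperm x (lpos k) ^ strans k)%g.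
  rewrite tpermJ /strans tpermL eq_rpos tpermD // 1?eq_sym //.
  by apply: contra_eq_neq eq_y => ->; rewrite neq_ltn ltnS leq_addr.
by rewrite groupJ // IHd.
Qed.

Lemma simples_gen (n : nat) (w : 'S_n.+1) :
  exists m, w \in (simples n ^+ m)%g.
Proof.
have gen_w : w \in <<simples n>>%g.
  have [ts -> _] := prod_tpermP w; rewrite group_prod // => -[x y] _ /=.
  have [le_xy | lt_yx] := leqP x y.
    by apply: (@tperm_simples _ (y - x)); rewrite subnKC.
  by rewrite tpermC; apply: (@tperm_simples _ (x - y)); rewrite subnKC // ltnW.
have /gen_prodgP[m [c c_in ->]] := gen_w.
exists m; elim: m c c_in => [|m IHm] c c_in.
  by rewrite big_ord0 expg0 inE.
by rewrite big_ord_recl expgS mem_mulg //; apply: IHm => i; apply: c_in.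
Qed.

(* length with respect to the simple transpositions: A ^+ m is the set of all
   products of m elements of A *)
Definition plen (n : nat) (w : 'S_n.+1) : nat := ex_minn (simples_gen w).

(* S_n^I *)
Definition minreps (n : nat) (I : {set 'I_n}) : {set 'S_n.+1} :=
  [set w | [forall (i | i \in I), plen (pcomp w (strans i)) == (plen w).+1]].

(* m^{I, epsilon, s_i}_{sigma, tau}(z; gamma), meant for sigma, tau in S_n^I.
   The sign epsilon_i is - if eps i is true and + otherwise. *)
Definition mcoef (R : realType) (p : R) (kappa : Cplx R) (n : nat)
    (I : {set 'I_n}) (eps : 'I_n -> bool) (z gamma : 'I_n.+1 -> Cplx R)
    (i : 'I_n) (sigma tau : 'S_n.+1) : Cplx R :=
  let k := rev_ord i in
  let x := z (lpos i) - z (rpos i) in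
  if pcomp (strans k) tau \in minreps I then
    let u := gamma ((tau^-1)%g (lpos k)) - gamma ((tau^-1)%g (rpos k)) in
    if sigma == tau then Acoef p kappa u x
    else if sigma == pcomp (strans k) tau then Bcoef p kappa u x
    else 0
  else if sigma == tau then
    if [pick j in I | pcomp (strans k) tau == pcomp tau (strans j)] is Some j
    then sgn R (eps j) * (ccoef p kappa x / ccoef p kappa (sgn R (eps j) * x))
    else 0
  else 0.

(* the multiplicities r = (r_1, r_2, r_3) with a in K_n[r] *)
Definition content (n : nat) (a : word n) : {ffun 'I_3 -> nat} :=
  [ffun j => #|[set i | a i == j]|].

Definition wact (n : nat) (w : 'S_n) (a : word n) : word n :=
  [ffun i => a ((w^-1)%g i)].

Definition alpha_r (n : nat) (r : {ffun 'I_3 -> nat}) : word n :=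
  [ffun i : 'I_n => if (i < r three3)%N then three3
                    else if (i < r three3 + r two3)%N then two3 else one3].

Definition I_r (n : nat) (r : {ffun 'I_3 -> nat}) : {set 'I_n} :=
  [set i : 'I_n | (i.+1 != r three3) && (i.+1 != r two3 + r three3)%N].

Definition eps_r (n : nat) (r : {ffun 'I_3 -> nat}) (i : 'I_n) : bool :=
  (i.+1 < r three3)%N.

Definition w_r (n : nat) (a : word n.+1) : 'S_n.+1 :=
  odflt 1%g [pick w in minreps (I_r n (content a)) |
               wact w (alpha_r n.+1 (content a)) == a].

(* eta_3 involves (n.+1) - 1 = n. *)
Definition gamma_r (R : realType) (p : R) (kappa : Cplx R)
    (phi : 'I_3 -> Cplx R) (n : nat) (r : {ffun 'I_3 -> nat})
    (i : 'I_n.+1) : Cplx R :=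
  let r1 := r one3 in
  let r2 := r two3 in
  let r3 := r three3 in
  let eta1 := - ipi_log p * r3%:R + r1.+1%:R * kappa in
  let eta2 := - ipi_log p * r3%:R + r2.+1%:R * kappa in
  let eta3 := - ipi_log p * n%:R - r3.+1%:R * kappa in
  if (i.+1 <= r3)%N then
    eta3 + phi three3 + 2%:R * i.+1%:R * kappa
  else if (i.+1 <= r3 + r2)%N then
    eta2 + phi two3 - 2%:R * (i.+1 - r3)%:R * kappa
  else
    eta1 + phi one3 - 2%:R * (i.+1 - r2 - r3)%:R * kappa.

Definition eta_r (n : nat) (r : {ffun 'I_3 -> nat}) (w : 'S_n) : nat :=
  #|[set ij : 'I_n * 'I_n |
      [&& (ij.2 < r three3)%N, (r three3 <= ij.1)%N & (w ij.1 < w ij.2)%N]]|.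

(* the modified monodromy operator at the simple transposition of index i *)
Definition Mtilde (R : realType) (p : R) (kappa : Cplx R)
    (phi : 'I_3 -> Cplx R) (n : nat) (z : 'I_n.+1 -> Cplx R) (i : 'I_n) :
    'End(tens R n.+1) :=
  linext (fun b =>
    let r := content b in
    \sum_(a : word n.+1 | content a == r)
      ((-1) ^+ (eta_r r (w_r a) + eta_r r (w_r b)) *
       mcoef p kappa (I_r n r) (eps_r r) z (gamma_r p kappa phi r) i
         (w_r a) (w_r b)) *: bvec R a).

(* Genericity of the parameters: the theta functions of the parameters in the
   denominators of A^{phi_i - phi_j} and B^{phi_i - phi_j} do not vanish. *)
Definition generic_dyn (R : realType) (p : R) (phi : 'I_3 -> Cplx R) : Prop :=
  forall i j : 'I_3, i != j -> thetap p (phi i - phi j) != 0.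

(* x avoids the poles of A^u, B^u and c and the zeros of c(x) and c(-x), so
   that the formulas compute the values at x of the meromorphic functions. *)
Definition generic_spec (R : realType) (p : R) (kappa x : Cplx R) : Prop :=
  [/\ thetap p x != 0, thetap p (- x) != 0,
      thetap p (2%:R * kappa - x) != 0 & thetap p (2%:R * kappa + x) != 0].

(* Main.v *)
(* The length of a permutation is its number of inversions, so S_n^I consists of
   the permutations that increase along every i in I. Hence w_alpha^-1 sends i to
   the start of the block of the letter alpha_i in alpha^(r), shifted by the
   number of earlier occurrences of that letter in alpha. This determines u, the
   product s_k w_beta and the parity of eta(w_beta) from the word beta, and so
   the column of the monodromy operator at beta for every n. For n = 3 the
   multiplicities and the numbers of earlier occurrences depend on the third
   letter only, and their contribution to u is the shift by Psi. *)
From mathcomp Require Import all_boot all_order all_algebra all_fingroup.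
From mathcomp Require Import reals complex.
From mathcomp Require Import zify ring.
(* Defs comes last so that pcomp does not denote the one of ssrfun. *)
Require Import Defs.

Set Implicit Arguments.
Unset Strict Implicit.
Unset Printing Implicit Defensive.

Import GRing.Theory.

(** * Coxeter length and minimal coset representatives of the symmetric group *)

Lemma pcompE n (w v : 'S_n) i : pcomp w v i = w (v i).
Proof. by rewrite permM. Qed.

Lemma rposE n (k : 'I_n) : rpos k = k.+1 :> nat.
Proof. by rewrite /= /bump add1n. Qed.

Lemma strans_val n (k : 'I_n) (i : 'I_n.+1) :
  strans k i =
    (if i == k :> nat then k.+1 else if i == k.+1 :> nat then k : nat else i) :> nat.
Proof.
rewrite /strans; case: tpermP => [->|->|ne_l ne_r].
- by rewrite rposE eqxx.
- by rewrite rposE (gtn_eqF (ltnSn k)) eqxx.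
case: eqP => [eq_i|_]; first by case: ne_l; apply: ord_inj.
by case: eqP => [eq_i|//]; case: ne_r; apply: ord_inj; rewrite /= eq_i -rposE.
Qed.

(** No integer lies strictly between [k] and [k.+1], so exchanging them can reverse only the pair
    that they form. *)
Lemma strans_lt n (k : 'I_n) (i j : 'I_n.+1) :
  i < j -> (i, j) != (lpos k, rpos k) -> strans k i < strans k j.
Proof.
move=> lt_ij /eqP ne; rewrite !strans_val.
have {}ne : ~ (i = k :> nat /\ j = k.+1 :> nat).
  move=> [ei ej]; apply: ne; congr (_, _); exact: ord_inj.
by do 4 ?[case: ifP => ?]; lia.
Qed.

Definition inversions n (w : 'S_n) : {set 'I_n * 'I_n} :=
  [set ij : 'I_n * 'I_n | (ij.1 < ij.2) && (w ij.2 < w ij.1)].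

(** Applying s_k to both entries of a pair carries the inversions of [w] onto those of w s_k other
    than (k, k+1), and the ascent of [w] at [k] makes that pair the single new inversion. *)
Lemma card_inversions_strans n (w : 'S_n.+1) (k : 'I_n) :
  w (lpos k) < w (rpos k) ->
  #|inversions (pcomp w (strans k))| = #|inversions w|.+1.
Proof.
move=> asc; set s := strans k.
have sK : involutive s by move=> i; rewrite /s /strans tpermK.
have lt_k : lpos k < rpos k by rewrite rposE.
pose f (ij : 'I_n.+1 * 'I_n.+1) := (s ij.1, s ij.2).
have fK : involutive f by case=> i j; rewrite /f /= !sK.
have nin : (lpos k, rpos k) \notin f @: inversions w.
  apply/imsetP => -[[i j]]; rewrite inE /= => /andP[lt_ij _] [eqi eqj].
  have := sK i; have := sK j; rewrite -eqi -eqj /s /strans tpermL tpermR.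
  by move=> ej ei; move: lt_ij; rewrite -ei -ej ltnNge (ltnW lt_k).
suff -> : inversions (pcomp w s) = (lpos k, rpos k) |: f @: inversions w.
  by rewrite cardsU1 nin (card_imset _ (inv_inj fK)).
apply/setP=> -[i j]; rewrite in_setU1 inE /= !pcompE.
have [[-> ->]|ne] := eqVneq (i, j) (lpos k, rpos k).
  by rewrite lt_k /s /strans tpermL tpermR asc.
rewrite -[(i, j) in RHS]fK (mem_imset _ _ (inv_inj fK)) inE /=.
have [gt_w|] := boolP (w (s j) < w (s i)); last by rewrite !andbF.
rewrite !andbT; apply/idP/idP => [lt_ij|lt_s]; first exact: strans_lt.
(* Here s_k is applied once more; the excluded pair cannot occur, because [w] descends along (s i, s
   j) but ascends at [k]. *)
rewrite -(sK i) -(sK j); apply: strans_lt => //.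
by apply: contraTneq gt_w => -[-> ->]; rewrite -leqNgt ltnW.
Qed.

(** This is the substitution [i = w q']. It turns a count of earlier letters of a word into a count
    of positions in alpha^(r). *)
Lemma card_lt_perm n (w : 'S_n) (P : pred 'I_n) (q : 'I_n) :
  #|[set i : 'I_n | (i < w q) && P (w^-1%g i)]| =
  #|[set q' : 'I_n | (w q' < w q) && P q']|.
Proof.
rewrite -[RHS](card_imset _ (@perm_inj _ w)); apply: eq_card => i.
rewrite inE -[i in RHS](permKV w) (mem_imset _ _ (@perm_inj _ w)) inE.
by rewrite permKV.
Qed.

Lemma card_ord_interval n a q : q <= n -> #|[set i : 'I_n | a <= i < q]| = q - a.
Proof.
move=> le_qn; rewrite -sum1_card (eq_bigl (fun i : 'I_n => a <= i < q)).
  rewrite -(big_mkord (fun i => a <= i < q) (fun=> 1)).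
  rewrite -(@big_nat_widen _ _ _ 0 q n (fun i => a <= i)) //.
  rewrite -(@big_nat_widenl _ _ _ a 0 q predT) //.
  by rewrite sum_nat_const_nat muln1.
by move=> i; rewrite inE.
Qed.

Lemma ascending_perm_eq1 n (w : 'S_n.+1) :
  (forall k : 'I_n, w (lpos k) < w (rpos k)) -> w = 1%g.
Proof.
move=> asc.
have mono d (i j : 'I_n.+1) : j = i + d.+1 :> nat -> w i < w j.
  elim: d j => [|d IH] j def_j; have ltj := ltn_ord j.
    have ltin : i < n by lia.
    have ei : i = lpos (Ordinal ltin) by apply: ord_inj.
    have ej : j = rpos (Ordinal ltin) by apply: ord_inj; rewrite rposE def_j addn1.
    by rewrite ei ej.
  have lt1 : i + d.+1 < n by lia.
  apply: ltn_trans (IH (lpos (Ordinal lt1)) erefl) _.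
  have -> : j = rpos (Ordinal lt1) by apply: ord_inj; rewrite rposE def_j addnS.
  exact: asc.
have lt_w (i j : 'I_n.+1) : i < j -> w i < w j.
  by move=> lt_ij; apply: (mono (j - i).-1); lia.
have ltE (i j : 'I_n.+1) : (w i < w j) = (i < j).
  case: (ltngtP i j) => [/lt_w ->|/lt_w|/ord_inj ->] //; last by rewrite ltnn.
  by case: ltngtP.
apply/permP=> q; rewrite perm1; apply: ord_inj.
(* Exactly [w q] values lie below [w q], and by monotonicity they are the images of the [q]
   positions below [q]. *)
have := card_lt_perm w predT q.
rewrite (eq_card (_ : _ =i [set i : 'I_n.+1 | 0 <= i < w q])); last first.
  by move=> i; rewrite !inE andbT.
rewrite [X in _ = X](eq_card (_ : _ =i [set i : 'I_n.+1 | 0 <= i < q])).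
  by rewrite !card_ord_interval ?subn0 // ltnW.
by move=> i; rewrite !inE ltE andbT.
Qed.

Lemma plenE n (w : 'S_n.+1) : plen w = #|inversions w|.
Proof.
have invK (v : 'S_n.+1) k : pcomp (pcomp v (strans k)) (strans k) = v.
  by apply/permP=> i; rewrite !pcompE /strans tpermK.
have desc (v : 'S_n.+1) k : v (rpos k) < v (lpos k) ->
    #|inversions v| = #|inversions (pcomp v (strans k))|.+1.
  move=> lt_v; rewrite -(@card_inversions_strans _ _ k) ?invK //.
  by rewrite !pcompE /strans tpermL tpermR.
have neq_k (v : 'S_n.+1) k : v (lpos k) <> v (rpos k) :> nat.
  by move/ord_inj/perm_inj/(congr1 val); rewrite /= /bump; lia.
rewrite /plen; case: ex_minnP => m w_m min_m; apply/eqP; rewrite eqn_leq.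
apply/andP; split.
  (* Upper bound, by sorting: each descent that is removed costs one generator and one inversion,
     and without descents only the identity remains. *)
  apply: min_m; move def_d: #|inversions w| => d.
  elim: d w def_d {m w_m} => [|d IH] w def_d.
    suff -> : w = 1%g by rewrite expg0 inE.
    apply: ascending_perm_eq1 => k; rewrite ltnNge leq_eqVlt negb_or.
    by apply/andP; split; [apply/eqP/nesym/neq_k | apply/negP=> /desc; rewrite def_d].
  have [/existsP[k lt_k]|] := boolP [exists k : 'I_n, w (rpos k) < w (lpos k)].
    have := desc _ _ lt_k; rewrite def_d => -[/esym/IH w'd].
    rewrite -(invK w k) expgS; apply: mem_mulg => //; exact: imset_f.
  rewrite negb_exists => /forallP asc.
  have w1 : w = 1%g.
    apply: ascending_perm_eq1 => k; move: (asc k) (neq_k w k).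
    lia.
  suff : #|inversions w| = 0 by rewrite def_d.
  rewrite w1; apply: eq_card0 => -[i j]; rewrite inE /= !perm1.
  by case: ltngtP.
(* Lower bound: each generator raises the number of inversions by at most one. *)
elim: m w w_m {min_m} => [|m IH] w.
  rewrite expg0 inE => /eqP ->; rewrite leqn0 cards_eq0; apply/eqP/setP => -[i j].
  by rewrite !inE /= !perm1; case: ltngtP.
rewrite expgS => /mulsgP[_ v /imsetP[k _ ->] /IH le_v ->].
have [lt_v|lt_v|/neq_k//] := ltngtP (v (lpos k)) (v (rpos k)).
  by rewrite (card_inversions_strans lt_v) ltnS.
by rewrite (leq_trans _ (leqW le_v)) // (desc _ _ lt_v) leqW.
Qed.

(** Composing with s_k on the right adds one inversion at an ascent and removes one at a descent, so
    the length condition on s_k only asks for an ascent at [k]. *)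
Lemma minrepsP n (I : {set 'I_n}) (w : 'S_n.+1) :
  reflect (forall k, k \in I -> w (lpos k) < w (rpos k)) (w \in minreps I).
Proof.
rewrite inE; apply: (iffP forall_inP) => asc k /asc.
  rewrite !plenE; have [//|lt_w|/ord_inj/perm_inj/(congr1 val)] :=
    ltngtP (w (lpos k)) (w (rpos k)); last by rewrite /= /bump; lia.
  have := @card_inversions_strans _ (pcomp w (strans k)) k.
  rewrite !pcompE /strans tpermL tpermR => /(_ lt_w).
  rewrite (_ : pcomp (pcomp _ _) _ = w); first by lia.
  by apply/permP=> i; rewrite !pcompE tpermK.
by rewrite !plenE => /card_inversions_strans ->.
Qed.

(** * Minimal representatives read off from words *)

(* The block of the letter c in alpha^(r) starts after block_start r c letters,
   and the i-th letter of b is preceded by occ b i letters equal to it. *)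
Definition block_start (r : {ffun 'I_3 -> nat}) (c : 'I_3) : nat :=
  if c == three3 then 0 else if c == two3 then r three3 else r three3 + r two3.

Definition occ n (b : word n) (i : 'I_n) : nat :=
  #|[set j : 'I_n | (j < i) && (b j == b i)]|.

Lemma I3P (c : 'I_3) : [\/ c = one3, c = two3 | c = three3].
Proof.
case: c => [[|[|[|]]]] // lt_c.
- by constructor 1; apply: ord_inj.
- by constructor 2; apply: ord_inj.
- by constructor 3; apply: ord_inj.
Qed.

Lemma sum_I3 (F : 'I_3 -> nat) : \sum_j F j = F one3 + F two3 + F three3.
Proof.
rewrite !big_ord_recl big_ord0 addn0 addnA.
by congr (F _ + F _ + F _); apply: ord_inj.
Qed.

Lemma content_sum n (b : word n) :
  content b one3 + content b two3 + content b three3 = n.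
Proof.
rewrite -sum_I3 -[RHS]card_ord -sum1_card (partition_big b predT) //=.
by apply: eq_bigr => j _; rewrite ffunE -sum1_card; apply: eq_bigl => i; rewrite inE.
Qed.

(** The block of ones is defined as what remains; the hypothesis on the sum makes it end after
    [r one3] letters. *)
Lemma alpha_rE n (r : {ffun 'I_3 -> nat}) (i : 'I_n) (c : 'I_3) :
  r one3 + r two3 + r three3 = n ->
  (alpha_r n r i == c) = (block_start r c <= i < block_start r c + r c).
Proof.
move=> sum_r; have lt_i := ltn_ord i.
have [->|->|->] := I3P c; rewrite /block_start /= ffunE;
  do 2?[case: ltnP => ? /=]; rewrite -val_eqE /=; lia.
Qed.

(** The excluded indices are the block boundaries of alpha^(r). An empty block makes them coincide
    or pushes one out of the range of indices. *)
Lemma mem_I_r n (r : {ffun 'I_3 -> nat}) (k : 'I_n) :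
  (k \in I_r n r) = (alpha_r n.+1 r (lpos k) == alpha_r n.+1 r (rpos k)).
Proof.
rewrite inE !ffunE rposE /=.
do 4?[case: ltnP => ? /=]; rewrite -val_eqE /=; lia.
Qed.

Lemma alpha_r_convex n r (i j k : 'I_n) :
  i <= j <= k -> alpha_r n r i = alpha_r n r k -> alpha_r n r j = alpha_r n r k.
Proof. by rewrite !ffunE; do 6?[case: ifP => ? //=]; lia. Qed.

(** Two positions with the same letter are joined by steps inside one block, and [w] ascends at each
    of these steps. *)
Lemma minreps_block_lt n r (w : 'S_n.+1) (i j : 'I_n.+1) :
  w \in minreps (I_r n r) -> alpha_r n.+1 r i = alpha_r n.+1 r j ->
  (w i < w j) = (i < j).
Proof.
move=> /minrepsP asc.
have lt_w d (i1 j1 : 'I_n.+1) : j1 = i1 + d.+1 :> nat ->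
    alpha_r n.+1 r i1 = alpha_r n.+1 r j1 -> w i1 < w j1.
  elim: d j1 => [|d IH] j1 def_j eq_a; have ltj := ltn_ord j1.
    have ltin : i1 < n by lia.
    have ei : i1 = lpos (Ordinal ltin) by apply: ord_inj.
    have ej : j1 = rpos (Ordinal ltin) by apply: ord_inj; rewrite rposE def_j addn1.
    by rewrite ei ej; apply: asc; rewrite mem_I_r -ei -ej eq_a.
  have lt1 : i1 + d.+1 < n by lia.
  have ej : j1 = rpos (Ordinal lt1) by apply: ord_inj; rewrite rposE def_j addnS.
  have eq_m : alpha_r n.+1 r (lpos (Ordinal lt1)) = alpha_r n.+1 r j1.
    by apply: (alpha_r_convex _ eq_a); rewrite /= def_j; lia.
  apply: ltn_trans (IH (lpos (Ordinal lt1)) erefl _) _; first by rewrite eq_m.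
  by rewrite ej; apply: asc; rewrite mem_I_r -ej eq_m.
move=> eq_a; have lt_w' (i1 j1 : 'I_n.+1) : i1 < j1 ->
    alpha_r n.+1 r i1 = alpha_r n.+1 r j1 -> w i1 < w j1.
  by move=> lt_ij; apply: (lt_w (j1 - i1).-1); lia.
case: (ltngtP i j) => [lt_ij|lt_ji|/ord_inj ->]; last by rewrite ltnn.
  by rewrite lt_w'.
by have := lt_w' _ _ lt_ji (esym eq_a); case: ltngtP.
Qed.

(** Put q = w^-1(i). Since [w] increases on each block, the occurrences of the letter [b i] before
    [i] correspond to the positions of its block before [q]; hence their number is the offset of [q]
    in the block. *)
Lemma minreps_inv n (b : word n.+1) (w : 'S_n.+1) (i : 'I_n.+1) :
  w \in minreps (I_r n (content b)) -> wact w (alpha_r n.+1 (content b)) = b ->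
  w^-1%g i = block_start (content b) (b i) + occ b i :> nat.
Proof.
set r := content b => w_min wact_b.
have sum_r : r one3 + r two3 + r three3 = n.+1 by apply: content_sum.
have bE j : b j = alpha_r n.+1 r (w^-1%g j) by rewrite -{1}wact_b ffunE.
set q := w^-1%g i; have def_i : i = w q by rewrite permKV.
have /andP[ge_q lt_q] :
    block_start r (b i) <= q < block_start r (b i) + r (b i).
  by rewrite -alpha_rE // bE.
suff -> : occ b i = q - block_start r (b i) by rewrite subnKC.
rewrite -(@card_ord_interval n.+1) ?(ltnW (ltn_ord q)) //.
transitivity #|[set q' | (w q' < w q) && (alpha_r n.+1 r q' == b i)]|.
  rewrite -(card_lt_perm w (fun q' => alpha_r n.+1 r q' == b i)).
  by apply: eq_card => j; rewrite !inE -def_i bE.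
apply: eq_card => q'; rewrite !inE.
have [eq_a|] := eqVneq (alpha_r n.+1 r q') (b i).
  have := eq_a; move/eqP; rewrite alpha_rE // => /andP[-> _].
  rewrite andbT (minreps_block_lt w_min) // eq_a bE //.
by rewrite andbF alpha_rE //; lia.
Qed.

Lemma occ_lt n (b : word n) (i j : 'I_n) :
  b i = b j -> (occ b i < occ b j) = (i < j).
Proof.
have occS (i1 j1 : 'I_n) : b i1 = b j1 -> i1 < j1 -> occ b i1 < occ b j1.
  move=> eq_b lt_ij; apply: proper_card; apply/properP; split.
    apply/subsetP=> k; rewrite !inE eq_b => /andP[lt_k ->].
    by rewrite (ltn_trans lt_k).
  by exists i1; rewrite !inE ?lt_ij ?eq_b ?eqxx ?ltnn.
move=> eq_b; case: (ltngtP i j) => [|lt_ji|/ord_inj ->]; last by rewrite ltnn.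
  exact: occS.
by have := occS _ _ (esym eq_b) lt_ji; case: ltngtP.
Qed.

Lemma occ_content n (b : word n) (i : 'I_n) : occ b i < content b (b i).
Proof.
rewrite ffunE; apply: proper_card; apply/properP; split.
  by apply/subsetP=> k; rewrite !inE => /andP[].
by exists i; rewrite !inE ?eqxx ?ltnn.
Qed.

(** The formula for the inverse serves as its definition. It is injective because alpha^(r) gives
    back the letter from the block, and occurrence numbers separate equal letters. *)
Lemma minreps_exists n (b : word n.+1) :
  exists2 w, w \in minreps (I_r n (content b)) &
             wact w (alpha_r n.+1 (content b)) = b.
Proof.
set r := content b.
have sum_r : r one3 + r two3 + r three3 = n.+1 by apply: content_sum.
have lt_v i : block_start r (b i) + occ b i < n.+1.
  have := occ_content b i; rewrite -/r /block_start.
  by have [->|->|->] := I3P (b i) => /=; lia.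
pose v i := Ordinal (lt_v i).
have alpha_v i : alpha_r n.+1 r (v i) = b i.
  by apply/eqP; rewrite alpha_rE //= leq_addr ltn_add2l occ_content.
have v_lt i j : b i = b j -> (v i < v j) = (i < j).
  by move=> eq_b; rewrite /= eq_b ltn_add2l occ_lt.
have v_inj : injective v.
  move=> i j eq_v; have eq_b : b i = b j by rewrite -!alpha_v eq_v.
  apply: ord_inj; have := v_lt _ _ eq_b; have := v_lt _ _ (esym eq_b).
  by rewrite eq_v ltnn; case: ltngtP.
exists (perm v_inj)^-1%g; last by apply/ffunP=> i; rewrite ffunE invgK permE.
apply/minrepsP => k; rewrite mem_I_r => /eqP.
set x := lpos k; set y := rpos k => eq_a.
have vK z : v ((perm v_inj)^-1%g z) = z.
  by have := permKV (perm v_inj) z; rewrite permE.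
have := v_lt ((perm v_inj)^-1%g x) ((perm v_inj)^-1%g y).
rewrite -!alpha_v !vK eq_a => /(_ erefl) <-.
by rewrite /x /y rposE.
Qed.

(** Existence rules out the default value [1%g] in the definition of [w_r]. *)
Lemma w_r_minreps n (b : word n.+1) : w_r b \in minreps (I_r n (content b)).
Proof.
rewrite /w_r; case: pickP => [w /andP[]//|none].
have [w w_min /eqP wact_w] := minreps_exists b.
by have := none w; rewrite w_min wact_w.
Qed.

Lemma wact_w_r n (b : word n.+1) : wact (w_r b) (alpha_r n.+1 (content b)) = b.
Proof.
rewrite /w_r; case: pickP => [w /andP[_ /eqP]//|none].
have [w w_min /eqP wact_w] := minreps_exists b.
by have := none w; rewrite w_min wact_w.
Qed.

Lemma w_r_inv n (b : word n.+1) (i : 'I_n.+1) :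
  (w_r b)^-1%g i = block_start (content b) (b i) + occ b i :> nat.
Proof. by apply: minreps_inv; [apply: w_r_minreps | apply: wact_w_r]. Qed.

Lemma w_r_uniq n (b : word n.+1) (w : 'S_n.+1) :
  w \in minreps (I_r n (content b)) -> wact w (alpha_r n.+1 (content b)) = b ->
  w = w_r b.
Proof.
move=> w_min wact_w; apply: invg_inj; apply/permP=> i; apply: ord_inj.
by rewrite /= w_r_inv; apply: minreps_inv.
Qed.

Lemma alpha_r_w_r n (b : word n.+1) (q : 'I_n.+1) :
  alpha_r n.+1 (content b) q = b (w_r b q).
Proof. by have /ffunP/(_ (w_r b q)) := wact_w_r b; rewrite ffunE permK. Qed.

Lemma content_wact n (w : 'S_n) (b : word n) : content (wact w b) = content b.
Proof.
apply/ffunP=> c; rewrite !ffunE -[RHS](card_imset _ (@perm_inj _ w)).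
apply: eq_card => i; rewrite inE ffunE -[i in RHS](permKV w).
by rewrite (mem_imset _ _ (@perm_inj _ w)) inE.
Qed.

(** * Simple transpositions acting on representatives, and the exponent eta *)

(** The only order that s_k can reverse is that of the values [k] and [k.+1]. They carry different
    letters, whereas minimality compares values with equal letters only. *)
Lemma pcomp_strans_w_r n (b : word n.+1) (k : 'I_n) :
  b (lpos k) != b (rpos k) ->
  pcomp (strans k) (w_r b) = w_r (wact (strans k) b).
Proof.
move=> ne_b; apply: w_r_uniq; rewrite content_wact.
  apply/minrepsP => i Ii; rewrite !pcompE; apply: strans_lt.
    exact: (minrepsP _ _ (w_r_minreps b)).
  apply: contra_neq ne_b => -[<- <-]; rewrite -!alpha_r_w_r.
  by apply/eqP; rewrite -mem_I_r.
apply/ffunP=> i; rewrite -[in RHS](wact_w_r b) !ffunE.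
by rewrite /pcomp invMg permM.
Qed.

(** Equal adjacent letters are consecutive occurrences, so the inverse of [w_r b] sends them to
    adjacent positions j, j+1 of one block. Conjugating the transposition then gives s_k w = w
    s_j. *)
Lemma w_r_pcomp_strans n (b : word n.+1) (k : 'I_n) :
  b (lpos k) = b (rpos k) ->
  exists2 j, j \in I_r n (content b) &
    pcomp (strans k) (w_r b) = pcomp (w_r b) (strans j) /\
    eps_r (content b) j = parity (b (lpos k)).
Proof.
move=> eq_b; pose v := (w_r b)^-1%g.
have occ_k : occ b (rpos k) = (occ b (lpos k)).+1.
  rewrite /occ -[RHS]add1n.
  rewrite (cardsD1 (lpos k)) inE rposE ltnSn eq_b eqxx; congr (_ + _).
  apply: eq_card => i; rewrite !inE -val_eqE ltnS /=.
  by rewrite ltn_neqAle andbA.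
have v_k : v (rpos k) = (v (lpos k)).+1 :> nat.
  by rewrite /v !w_r_inv eq_b occ_k addnS.
have lt_j : v (lpos k) < n by have := ltn_ord (v (rpos k)); lia.
pose j := Ordinal lt_j.
have lj : lpos j = v (lpos k) by apply: ord_inj.
have rj : rpos j = v (rpos k) by apply: ord_inj; rewrite rposE.
have wl : w_r b (lpos j) = lpos k by rewrite lj permKV.
have wr : w_r b (rpos j) = rpos k by rewrite rj permKV.
exists j; first by rewrite mem_I_r !alpha_r_w_r wl wr eq_b.
split.
  by rewrite /pcomp /strans -wl -wr -tpermJ conjgE mulKVg.
(* The test [j.+1 < r three3] in [eps_r] says that the right position of [j] is in the block of
   threes, hence the passage to [rpos k]. *)
by rewrite /parity eq_b -wr -alpha_r_w_r alpha_rE ?content_sum.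
Qed.

(** Applying [w_r b] to both entries turns block positions into positions of letters: eta counts the
    pairs in which another letter stands to the left of a three. *)
Lemma eta_r_w_r n (b : word n.+1) :
  eta_r (content b) (w_r b) =
  #|[set ij : 'I_n.+1 * 'I_n.+1 |
      [&& b ij.2 == three3, b ij.1 != three3 & ij.1 < ij.2]]|.
Proof.
pose f (ij : 'I_n.+1 * 'I_n.+1) := (w_r b ij.1, w_r b ij.2).
have f_inj : injective f by case=> i j [i' j'] [/perm_inj -> /perm_inj ->].
rewrite /eta_r -(card_imset _ f_inj); apply: eq_card => -[i j].
have -> : (i, j) = f ((w_r b)^-1%g i, (w_r b)^-1%g j) by rewrite /f /= !permKV.
rewrite (mem_imset _ _ f_inj) !inE /= -!alpha_r_w_r !alpha_rE ?content_sum //.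
by rewrite /block_start /= !add0n -leqNgt.
Qed.


(** * Linear operators on tensor powers, in coordinates *)

Local Open Scope ring_scope.

Lemma linext_bvec (R : realType) n (f : word n -> tens R n) (a : word n) :
  linext f (bvec R a) = f a.
Proof.
rewrite lfunE /= /linext_fun (bigD1 a) //= ffunE eqxx scale1r big1 ?addr0 // => b ne.
by rewrite ffunE (negbTE ne) scale0r.
Qed.

Definition cat_word m n (u : word m) (v : word n) : word (m + n) :=
  [ffun i => match split i with inl j => u j | inr j => v j end].

Lemma lword_cat m n (u : word m) (v : word n) : lword (cat_word u v) = u.
Proof.
by apply/ffunP=> i; rewrite !ffunE; have := unsplitK (inl i : 'I_m + 'I_n) => /= ->.
Qed.

Lemma rword_cat m n (u : word m) (v : word n) : rword (cat_word u v) = v.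
Proof.
by apply/ffunP=> i; rewrite !ffunE; have := unsplitK (inr i : 'I_m + 'I_n) => /= ->.
Qed.

Lemma cat_lrword m n (w : word (m + n)) : cat_word (lword w) (rword w) = w.
Proof.
apply/ffunP=> i; rewrite ffunE -[i in RHS]splitK.
by case: (split i) => j; rewrite ffunE.
Qed.

Lemma tensv_bvec (R : realType) m n (u : word m) (v : word n) :
  tensv (bvec R u) (bvec R v) = bvec R (cat_word u v).
Proof.
apply/ffunP=> w; rewrite !ffunE -natrM mulnb; congr (_%:R); congr nat_of_bool.
apply/andP/eqP => [[/eqP <- /eqP <-]|->]; first by rewrite cat_lrword.
by rewrite lword_cat rword_cat.
Qed.

Lemma tensvDl (R : realType) m n (u u' : tens R m) (v : tens R n) :
  tensv (u + u') v = tensv u v + tensv u' v.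
Proof. by apply/ffunP=> w; rewrite !ffunE mulrDl. Qed.

Lemma tensvDr (R : realType) m n (u : tens R m) (v v' : tens R n) :
  tensv u (v + v') = tensv u v + tensv u v'.
Proof. by apply/ffunP=> w; rewrite !ffunE mulrDr. Qed.

Lemma tensvZl (R : realType) m n (k : Cplx R) (u : tens R m) (v : tens R n) :
  tensv (k *: u) v = k *: tensv u v.
Proof. by apply/ffunP=> w; rewrite !ffunE -mulrA. Qed.

Lemma tensvZr (R : realType) m n (k : Cplx R) (u : tens R m) (v : tens R n) :
  tensv u (k *: v) = k *: tensv u v.
Proof. by apply/ffunP=> w; rewrite !ffunE mulrCA. Qed.

(** * Columns of the monodromy operator in arbitrary rank *)

(** Equal letters at [k] and [k.+1] put s_k w_b outside S_n^I, which leaves the diagonal scalar.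
    Different letters make it the representative of the swapped word, so that just two entries
    survive. *)
Lemma Mtilde_bvec (R : realType) (p : R) (kappa : Cplx R)
    (phi : 'I_3 -> Cplx R) n (z : 'I_n.+1 -> Cplx R) (i : 'I_n)
    (b : word n.+1) :
  let k := rev_ord i in
  let x := z (lpos i) - z (rpos i) in
  let sb := wact (strans k) b in
  let g q := gamma_r p kappa phi (content b) ((w_r b)^-1%g q) in
  let u := g (lpos k) - g (rpos k) in
  Mtilde p kappa phi z i (bvec R b) =
  if b (lpos k) == b (rpos k) then
    (sgn R (parity (b (lpos k))) *
       (ccoef p kappa x / ccoef p kappa (sgn R (parity (b (lpos k))) * x))) *:
    bvec R b
  else
    Acoef p kappa u x *: bvec R b +
    ((-1) ^+ (eta_r (content b) (w_r sb) + eta_r (content b) (w_r b)) *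
       Bcoef p kappa u x) *: bvec R sb.
Proof.
move=> k x sb g u.
have w_inj a a' : content a = content a' -> w_r a = w_r a' -> a = a' :> word n.+1.
  by move=> eq_c eq_w; rewrite -(wact_w_r a) -(wact_w_r a') eq_c eq_w.
(* On the diagonal the exponent of the sign is twice eta, so the sign is 1. *)
rewrite /Mtilde linext_bvec (bigD1 b) //= addnn -mul2n exprM sqrrN !expr1n mul1r.
rewrite {1}/mcoef -/k -/x eqxx.
have [eq_b|ne_b] := eqVneq (b (lpos k)) (b (rpos k)).
  have [j Ij [def_j eps_j]] := w_r_pcomp_strans eq_b.
  (* Being equal to w_b s_j with [j] in I, this permutation has a descent at [j]. *)
  have nmin : pcomp (strans k) (w_r b) \notin minreps (I_r n (content b)).
    apply/minrepsP => /(_ j Ij); rewrite def_j !pcompE /strans tpermL tpermR.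
    by apply/negP; rewrite -leqNgt ltnW //; apply: (minrepsP _ _ (w_r_minreps b)).
  rewrite (negbTE nmin); case: pickP => [j' /andP[_]|/(_ j)]; last first.
    by rewrite Ij def_j eqxx.
  (* The index found by [pick] is [j]: cancelling w_b identifies the two simple transpositions, and
     the image of [lpos j] determines the index. *)
  rewrite def_j => /eqP/mulIg eq_j.
  have -> : j' = j.
    apply: ord_inj; have := strans_val j (lpos j).
    have := strans_val j' (lpos j); rewrite -eq_j => ->.
    by rewrite eqxx; do 2?[case: eqP => ? /=]; lia.
  rewrite eps_j big1 ?addr0 // => a /andP[/eqP cont_a ne_a].
  rewrite /mcoef -/k (negbTE nmin).
  case: eqP => [/(w_inj _ _ cont_a) eq_a|_]; first by rewrite eq_a eqxx in ne_a.
  by rewrite mulr0 scale0r.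
have min_s : pcomp (strans k) (w_r b) \in minreps (I_r n (content b)).
  by rewrite (pcomp_strans_w_r ne_b) -(content_wact (strans k) b) w_r_minreps.
have ne_sb : sb != b.
  apply: contra ne_b => /eqP/ffunP/(_ (lpos k)).
  by rewrite ffunE tpermV tpermL => ->.
rewrite min_s; congr (_ + _).
rewrite (bigD1 sb) /=; last by rewrite content_wact eqxx.
rewrite {1}/mcoef -/k -/x min_s (pcomp_strans_w_r ne_b) eqxx.
rewrite ifN; last by apply: contra_neq ne_sb => /w_inj; apply; apply: content_wact.
rewrite -/sb big1 ?addr0 // => a /andP[/andP[/eqP cont_a ne_a] ne_a'].
rewrite /mcoef -/k min_s (pcomp_strans_w_r ne_b) -/sb.
case: eqP => [/(w_inj _ _ cont_a) eq_a|_]; first by rewrite eq_a eqxx in ne_a.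
case: eqP => [/w_inj eq_a|_]; last by rewrite mulr0 scale0r.
by rewrite eq_a ?eqxx ?content_wact in ne_a'.
Qed.

(* gamma^(r) at the m-th position, counted from 0, of the block of the letter c *)
Definition letter_gamma (R : realType) (p : R) (kappa : Cplx R)
    (phi : 'I_3 -> Cplx R) (n : nat) (r : {ffun 'I_3 -> nat})
    (c : 'I_3) (m : nat) : Cplx R :=
  if c == three3 then
    - ipi_log p * n%:R - (r three3).+1%:R * kappa + phi c + 2%:R * m.+1%:R * kappa
  else
    - ipi_log p * (r three3)%:R + (r c).+1%:R * kappa + phi c
      - 2%:R * m.+1%:R * kappa.

Lemma gamma_r_w_r (R : realType) (p : R) (kappa : Cplx R)
    (phi : 'I_3 -> Cplx R) n (b : word n.+1) (i : 'I_n.+1) :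
  gamma_r p kappa phi (content b) ((w_r b)^-1%g i) =
  letter_gamma p kappa phi n (content b) (b i) (occ b i).
Proof.
(* The bound on the occurrence number keeps the position inside its block, which selects the branch
   of [gamma_r]; the start of the block then cancels. *)
have occ_i := occ_content b i; rewrite /gamma_r w_r_inv /letter_gamma.
have [eq_c|eq_c|eq_c] := I3P (b i); rewrite eq_c in occ_i *;
  rewrite /block_start /=.
- rewrite ifF; last by lia.
  rewrite ifF; last by lia.
  by congr (_ - _ * _%:R * _); lia.
- rewrite ifF; last by lia.
  rewrite ifT; last by lia.
  by congr (_ - _ * _%:R * _); lia.
- by rewrite ifT.
Qed.

(** * Statistics of words of length three *)

Lemma content3 (b : word 3) c :
  content b c = ((b one3 == c) + (b two3 == c) + (b three3 == c))%N.
Proof. by rewrite ffunE -sum1dep_card big_mkcond /= sum_I3; do 3 case: eqP. Qed.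

Lemma occ3 (b : word 3) (i : 'I_3) :
  occ b i = (((0 < i) && (b one3 == b i)) + ((1 < i) && (b two3 == b i)))%N.
Proof.
rewrite /occ -sum1dep_card big_mkcond /= sum_I3 [X in (_ + X)%N]ifN ?addn0; last first.
  by case: (i) => [[|[|[|]]]].
by do 2 case: (_ && _).
Qed.

Lemma eta_r3 (b : word 3) :
  eta_r (content b) (w_r b) =
  (((b one3 != three3) && (b two3 == three3)) +
   ((b one3 != three3) && (b three3 == three3)) +
   ((b two3 != three3) && (b three3 == three3)))%N.
Proof.
rewrite eta_r_w_r -sum1dep_card big_mkcond /=.
rewrite -(pair_bigA _ (fun i j : 'I_3 =>
  if [&& b j == three3, b i != three3 & (i < j)%N] then 1 else 0)) /=.
rewrite !sum_I3 /= !andbF !andbT ?add0n ?addn0.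
by do 3 case: (_ == three3).
Qed.

Lemma endo_eq_bvec (R : realType) n (F G : 'End(tens R n)) :
  (forall b, F (bvec R b) = G (bvec R b)) -> F = G.
Proof.
move=> eqFG; apply/lfunP => v.
have -> : v = \sum_a (v a : Cplx R) *: bvec R a.
  apply/ffunP=> b; rewrite sum_ffunE (bigD1 b) //= !ffunE eqxx big1 => [|a ne_a].
    by rewrite addr0 [RHS]mulr1.
  by rewrite !ffunE eq_sym (negbTE ne_a) [LHS]mulr0.
by rewrite !linear_sum; apply: eq_bigr => a _; rewrite !linearZ /= eqFG.
Qed.

Lemma word3P (a b : word 3) :
  a one3 = b one3 -> a two3 = b two3 -> a three3 = b three3 -> a = b.
Proof. by move=> e1 e2 e3; apply/ffunP=> i; have [->|->|->] := I3P i. Qed.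

(** * The dynamical R-matrix on two of three tensor factors *)

Lemma cat_word_lshift m n (u : word m) (v : word n) j :
  cat_word u v (lshift n j) = u j.
Proof. by have /ffunP/(_ j) := lword_cat u v; rewrite ffunE. Qed.

Lemma cat_word_rshift m n (u : word m) (v : word n) j :
  cat_word u v (rshift m j) = v j.
Proof. by have /ffunP/(_ j) := rword_cat u v; rewrite ffunE. Qed.

Lemma cat_word21 (i j : 'I_3) (v : word 1) :
  let a : word 3 := cat_word (m := 2) (n := 1) (word2 i j) v in
  [/\ a one3 = i, a two3 = j & a three3 = v ord0].
Proof.
have e1 : one3 = lshift 1 (ord0 : 'I_2) by apply: ord_inj.
have e2 : two3 = lshift 1 (ord_max : 'I_2) by apply: ord_inj.
have e3 : three3 = rshift 2 (ord0 : 'I_1) by apply: ord_inj.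
by move=> a; split; rewrite ?e1 ?e2 ?e3;
  (apply: etrans (cat_word_lshift _ _ _) _ ||
   apply: etrans (cat_word_rshift _ _ _) _);
  rewrite ?ffunE.
Qed.

Lemma cat_word12 (v : word 1) (i j : 'I_3) :
  let a : word 3 := cat_word (m := 1) (n := 2) v (word2 i j) in
  [/\ a one3 = v ord0, a two3 = i & a three3 = j].
Proof.
have e1 : one3 = lshift 2 (ord0 : 'I_1) by apply: ord_inj.
have e2 : two3 = rshift 1 (ord0 : 'I_2) by apply: ord_inj.
have e3 : three3 = rshift 1 (ord_max : 'I_2) by apply: ord_inj.
by move=> a; split; rewrite ?e1 ?e2 ?e3;
  (apply: etrans (cat_word_lshift _ _ _) _ ||
   apply: etrans (cat_word_rshift _ _ _) _);
  rewrite ?ffunE.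
Qed.

Lemma Rmat_bvec (R : realType) (p : R) (kappa x : Cplx R)
    (phi : 'I_3 -> Cplx R) (i j : 'I_3) :
  Rmat p kappa x phi (bvec R (word2 i j)) =
  if i == j then
    (sgn R (parity i) *
      (ccoef p kappa x / ccoef p kappa (sgn R (parity i) * x))) *: bvec R (word2 i j)
  else
    Acoef p kappa (phi i - phi j) x *: bvec R (word2 i j) +
    ((-1) ^+ (parity i + parity j)%N * Bcoef p kappa (phi i - phi j) x) *:
    bvec R (word2 j i).
Proof. by rewrite linext_bvec !ffunE /=; case: eqP => [->|]. Qed.

(** The index is any [k] of value 0, so that it can be instantiated by a reversed index, and the
    swapped vector is written with [wact] to match [Mtilde_bvec]. *)
Lemma R12_bvec (R : realType) (p : R) (kappa x : Cplx R)
    (phi : 'I_3 -> Cplx R) (b : word 3) (k : 'I_2) :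
  k = 0%N :> nat ->
  let i := b one3 in let j := b two3 in
  R12 p kappa x phi (bvec R b) =
  if i == j then
    (sgn R (parity i) *
      (ccoef p kappa x / ccoef p kappa (sgn R (parity i) * x))) *: bvec R b
  else
    Acoef p kappa (phi i - phi j) x *: bvec R b +
    ((-1) ^+ (parity i + parity j)%N * Bcoef p kappa (phi i - phi j) x) *:
    bvec R (wact (strans k) b).
Proof.
move=> k0 i j; rewrite /R12 /tensop linext_bvec id_lfunE.
pose v : word 1 := rword (m := 2) (n := 1) b.
have e1 : lpos k = one3 by apply: ord_inj; rewrite /= k0.
have e2 : rpos k = two3 by apply: ord_inj; rewrite rposE k0.
have v0 : v ord0 = b three3 by rewrite ffunE; congr (b _); apply: ord_inj.
have catE : cat_word (word2 i j) v = b.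
  by have [] := cat_word21 i j v; rewrite v0; apply: word3P.
have catsE : cat_word (word2 j i) v = wact (strans k) b.
  have [c1 c2 c3] := cat_word21 j i v.
  apply: word3P; rewrite ?c1 ?c2 ?c3 ?v0 ffunE /strans e1 e2 tpermV.
  - by rewrite tpermL.
  - by rewrite tpermR.
  - by rewrite tpermD.
have -> : lword (m := 2) (n := 1) b = word2 i j.
  by rewrite -[b in LHS]catE lword_cat.
rewrite Rmat_bvec -/v; case: ifP => _; rewrite ?tensvDl !tensvZl !tensv_bvec.
  by rewrite catE.
by rewrite catE catsE.
Qed.

Lemma R23_bvec (R : realType) (p : R) (kappa x : Cplx R)
    (phi : 'I_3 -> Cplx R) (b : word 3) (k : 'I_2) :
  k = 1%N :> nat ->
  let i := b two3 in let j := b three3 in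
  R23 p kappa x phi (bvec R b) =
  if i == j then
    (sgn R (parity i) *
      (ccoef p kappa x / ccoef p kappa (sgn R (parity i) * x))) *: bvec R b
  else
    Acoef p kappa (phi i - phi j) x *: bvec R b +
    ((-1) ^+ (parity i + parity j)%N * Bcoef p kappa (phi i - phi j) x) *:
    bvec R (wact (strans k) b).
Proof.
move=> k1 i j; rewrite /R23 /tensop linext_bvec id_lfunE.
pose v : word 1 := lword (m := 1) (n := 2) b.
have e1 : lpos k = two3 by apply: ord_inj; rewrite /= k1.
have e2 : rpos k = three3 by apply: ord_inj; rewrite rposE k1.
have v0 : v ord0 = b one3 by rewrite ffunE; congr (b _); apply: ord_inj.
have catE : cat_word v (word2 i j) = b.
  by have [] := cat_word12 v i j; rewrite v0; apply: word3P.
have catsE : cat_word v (word2 j i) = wact (strans k) b.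
  have [c1 c2 c3] := cat_word12 v j i.
  apply: word3P; rewrite ?c1 ?c2 ?c3 ?v0 ffunE /strans e1 e2 tpermV.
  - by rewrite tpermD.
  - by rewrite tpermL.
  - by rewrite tpermR.
have -> : rword (m := 1) (n := 2) b = word2 i j.
  by rewrite -[b in LHS]catE rword_cat.
rewrite Rmat_bvec -/v; case: ifP => _; rewrite ?tensvDr !tensvZr !tensv_bvec.
  by rewrite catE.
by rewrite catE catsE.
Qed.

(** * Comparison of dynamical parameters and signs *)

(** Let a be the first letter and let the other two differ. A letter c has multiplicity 1 + [a = c]
    and occurrence number [a = c], so its multiple of [kappa] is -[a = c] for c = 1, 2 and [a = 3]
    for c = 3. If one of the two is a three, then r_3 - 2 = [a = 3] - 1 gives the imaginary shift;
    otherwise the imaginary parts cancel. *)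
Lemma letter_gamma_23 (R : realType) (p : R) (kappa : Cplx R)
    (phi : 'I_3 -> Cplx R) (b : word 3) :
  b two3 != b three3 ->
  letter_gamma p kappa phi 2 (content b) (b two3) (occ b two3) -
  letter_gamma p kappa phi 2 (content b) (b three3) (occ b three3) =
  (phi \+ Psi p kappa (b one3)) (b two3) -
  (phi \+ Psi p kappa (b one3)) (b three3).
Proof.
rewrite /letter_gamma !occ3 !content3 /=.
move: (b one3) (b two3) (b three3) => i j k.
have [->|->|->] := I3P i; have [->|->|->] := I3P j; have [->|->|->] := I3P k => //= _;
  by rewrite /Psi /vec3 /=; ring.
Qed.

(** Now the first two letters differ and have occurrence number 0. The last letter enters through
    the multiplicities only, which reverses the sign of the multiples of [kappa]. *)
Lemma letter_gamma_12 (R : realType) (p : R) (kappa : Cplx R)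
    (phi : 'I_3 -> Cplx R) (b : word 3) :
  b one3 != b two3 ->
  letter_gamma p kappa phi 2 (content b) (b one3) (occ b one3) -
  letter_gamma p kappa phi 2 (content b) (b two3) (occ b two3) =
  (phi \+ Psi p (- kappa) (b three3)) (b one3) -
  (phi \+ Psi p (- kappa) (b three3)) (b two3).
Proof.
rewrite /letter_gamma !occ3 !content3 /=.
move: (b one3) (b two3) (b three3) => i j k.
have [->|->|->] := I3P i; have [->|->|->] := I3P j; have [->|->|->] := I3P k => //= _;
  by rewrite /Psi /vec3 /=; ring.
Qed.

Lemma positions3_0 (k : 'I_2) :
  k = 0%N :> nat -> lpos k = one3 /\ rpos k = two3.
Proof. by move=> k0; split; apply: ord_inj; rewrite ?rposE /= k0. Qed.

Lemma positions3_1 (k : 'I_2) :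
  k = 1%N :> nat -> lpos k = two3 /\ rpos k = three3.
Proof. by move=> k1; split; apply: ord_inj; rewrite ?rposE /= k1. Qed.

(** Swapping different adjacent letters changes eta by one if one of them is a three, and leaves it
    unchanged otherwise. *)
Lemma eta_sign (R : realType) (b : word 3) (k : 'I_2) :
  b (lpos k) != b (rpos k) ->
  (-1) ^+ (eta_r (content b) (w_r (wact (strans k) b)) +
           eta_r (content b) (w_r b)) =
  (-1) ^+ (parity (b (lpos k)) + parity (b (rpos k))) :> Cplx R.
Proof.
(* Writing the content as that of the swapped word makes [eta_r3] applicable to it. *)
have -> : eta_r (content b) (w_r (wact (strans k) b)) =
          eta_r (content (wact (strans k) b)) (w_r (wact (strans k) b)).
  by rewrite content_wact.
rewrite !eta_r3 /parity /strans.
have [k0|k1] : k = 0%N :> nat \/ k = 1%N :> nat by have := ltn_ord k; lia.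
  have [-> ->] := positions3_0 k0; rewrite !ffunE tpermV tpermL tpermR tpermD //.
  move: (b one3) (b two3) (b three3) => i j l.
  have [->|->|->] := I3P i; have [->|->|->] := I3P j; have [->|->|->] := I3P l => //= _;
    ring.
have [-> ->] := positions3_1 k1; rewrite !ffunE tpermV tpermL tpermR tpermD //.
move: (b one3) (b two3) (b three3) => i j l.
have [->|->|->] := I3P i; have [->|->|->] := I3P j; have [->|->|->] := I3P l => //= _;
  ring.
Qed.

Theorem lemma6p4 (R : realType) (p : R) (kappa : Cplx R)
    (phi z : 'I_3 -> Cplx R)
    (hp : 0 < p < 1)
    (hphi1 : forall j : 'I_3, generic_dyn p (phi \+ Psi p kappa j))
    (hphi2 : forall j : 'I_3, generic_dyn p (phi \+ Psi p (- kappa) j)) :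
  (generic_spec p kappa (z one3 - z two3) ->
     Mtilde p kappa phi z (@Ordinal 2 0 isT) =
     dynshift (R23 p kappa (z one3 - z two3)) phi (Psi p kappa) one3) /\
  (generic_spec p kappa (z two3 - z three3) ->
     Mtilde p kappa phi z (@Ordinal 2 1 isT) =
     dynshift (R12 p kappa (z two3 - z three3)) phi (Psi p (- kappa)) three3).
Proof.
split=> _; apply: endo_eq_bvec => b; rewrite Mtilde_bvec /dynshift linext_bvec;
  set i : 'I_2 := Ordinal _; set k := rev_ord i.
(* The spectral parameter uses the positions of [i], the letters those of [rev_ord i]; this is why
   s_1 acts on the last two factors with z_1 - z_2. *)
- have [-> ->] := @positions3_0 i erefl; have [kl kr] := @positions3_1 k erefl.
  rewrite (@R23_bvec _ _ _ _ _ _ k erefl) kl kr.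
  (* For equal letters both sides are the same scalar, in which the dynamical parameters do not
     occur. *)
  have [//|ne_b] := eqVneq (b two3) (b three3); rewrite -kl -kr in ne_b.
  rewrite (eta_sign R ne_b) !gamma_r_w_r; rewrite kl kr in ne_b *.
  by rewrite (letter_gamma_23 _ _ _ ne_b).
- have [-> ->] := @positions3_1 i erefl; have [kl kr] := @positions3_0 k erefl.
  rewrite (@R12_bvec _ _ _ _ _ _ k erefl) kl kr.
  have [//|ne_b] := eqVneq (b one3) (b two3); rewrite -kl -kr in ne_b.
  rewrite (eta_sign R ne_b) !gamma_r_w_r; rewrite kl kr in ne_b *.
  by rewrite (letter_gamma_12 _ _ _ ne_b).
Qed.
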